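(* Let $X$ be a Noetherian space. The irreducible closed subsets of $X^{\leq\omega}$ (with the asymptotic subword topology) are exactly the finite-or-infinite word products. The irreducible closed subsets of $X^\omega$ (with the asymptotic subword topology) are exactly the infinite word products.
   Context: A topological space is Noetherian if every open subset is compact (no separation assumed). A subset $C$ of a space is irreducible if it is non-empty and, whenever $C \subseteq C_1 \cup C_2$ with $C_1, C_2$ closed, $C \subseteq C_1$ or $C \subseteq C_2$. $X^*$ is the set of finite words over $X$, $X^\omega$ the set of infinite words (functions $\mathbb{N} \to X$), and $X^{\leq\omega} = X^* \cup X^\omega$. For open subsets $U_1, \ldots, U_n, U$ of $X$ ($n \in \mathbb{N}$), $\langle U_1; \cdots; U_n\rangle$ is the set of finite or infinite words containing a letter in $U_1$, then at a later position a letter in $U_2$, and so on, until a letter in $U_n$ (for $n=0$, all words); $\langle U_1; \cdots; U_n; (\infty) U\rangle$ is the set of words that can be written as $uw$ with $u$ a finite word in $\langle U_1; \cdots; U_n\rangle$ and $w$ having letters from $U$ at infinitely many positions. The asymptotic subword topology on $X^{\leq\omega}$ is generated by all these sets as subbasic open sets; $X^\omega$ has the subspace topology. For $C \subseteq X$, $C^?$ is the set of words of length at most one whose letter, if any, is in $C$; for $F \subseteq X$, $F^*$ (resp. $F^\omega$, $F^{\leq\omega}$) is the set of finite (resp. infinite, finite-or-infinite) words all of whose letters are in $F$; juxtaposition denotes elementwise concatenation of languages. A word product is a language $P = A_1 A_2 \cdots A_N \subseteq X^*$ ($N \in \mathbb{N}$, with $P = \{\epsilon\}$ if $N=0$) where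 each $A_i$ is either $C^?$ with $C$ irreducible closed in $X$, or $F^*$ with $F$ closed in $X$. A finite-or-infinite word product is a set of the form $P F^{\leq\omega}$ with $P$ a word product and $F$ a (possibly empty) closed subset of $X$. An infinite word product is a set of the form $P F^\omega$ with $P$ a word product and $F$ a non-empty closed subset of $X$. *)

(* Defs.v *)
From HB Require Import structures.
From mathcomp Require Import all_boot all_order.
From mathcomp Require Import all_classical topology.

Set Implicit Arguments.
Unset Strict Implicit.
Unset Printing Implicit Defensive.

Local Open Scope classical_set_scope.

Definition noetherian (X : topologicalType) : Prop :=
  forall U : set X, open U -> compact U.

Definition irreducible_set (X : topologicalType) (C : set X) : Prop :=
  C !=set0 /\
  forall C1 C2 : set X, closed C1 -> closed C2 ->
    C `<=` C1 `|` C2 -> C `<=` C1 \/ C `<=` C2.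

Definition irreducible_closed (X : topologicalType) (C : set X) : Prop :=
  closed C /\ irreducible_set C.

Inductive fiword (X : Type) : Type :=
| Fin of seq X
| Inf of (nat -> X).

Section Words.
Variable X : choiceType.

Definition letter (w : fiword X) (i : nat) : option X :=
  match w with Fin s => onth s i | Inf f => Some (f i) end.

Definition letter_in (U : set X) (w : fiword X) (i : nat) : Prop :=
  exists2 x, letter w i = Some x & U x.

(* The default value of [nth] is the letter of the infinite part, so that no
   distinguished element of X is needed. *)
Definition prepend (u : seq X) (f : nat -> X) : nat -> X :=
  fun n => nth (f (n - size u)%N) u n.

Definition catw (u : seq X) (w : fiword X) : fiword X :=
  match w with Fin s => Fin (u ++ s) | Inf f => Inf (prepend u f) end.

(* Letters in U_1, ..., U_n at strictly increasing positions, all >= k. *)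
Fixpoint subword_from (k : nat) (Us : seq (set X)) (w : fiword X) : Prop :=
  match Us with
  | [::] => True
  | U :: Us' => exists i, [/\ (k <= i)%N, letter_in U w i
                            & subword_from i.+1 Us' w]
  end.

Definition subword_set (Us : seq (set X)) : set (fiword X) :=
  [set w | subword_from 0 Us w].

Definition infinitely_often (U : set X) : set (fiword X) :=
  [set w | forall n, exists2 i, (n <= i)%N & letter_in U w i].

Definition subword_inf_set (Us : seq (set X)) (U : set X) : set (fiword X) :=
  [set catw u w | u in [set u | subword_set Us (Fin u)]
                & w in infinitely_often U].

Definition lang_cat (A B : set (seq X)) : set (seq X) :=
  [set u ++ v | u in A & v in B].

Definition lang_opt (C : set X) : set (seq X) :=
  [set u | (size u <= 1)%N /\ {in u, forall x, C x}].

Definition lang_star (F : set X) : set (seq X) :=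
  [set u | {in u, forall x, F x}].

Definition lang_omega (F : set X) : set (nat -> X) :=
  [set f | forall i, F (f i)].

Definition lang_leomega (F : set X) : set (fiword X) :=
  [set w | forall i x, letter w i = Some x -> F x].

End Words.

HB.instance Definition _ (X : Type) := gen_eqMixin (fiword X).
HB.instance Definition _ (X : Type) := gen_choiceMixin (fiword X).

Definition asymptotic_subbase (X : topologicalType) : set (set (fiword X)) :=
  [set V | exists2 Us : seq (set X), {in Us, forall U, open U} &
     V = subword_set Us \/
     exists2 U : set X, open U & V = subword_inf_set Us U].

HB.instance Definition _ (X : topologicalType) :=
  isSubBaseTopological.Build (fiword X) (@asymptotic_subbase X) id.

(* X^omega, with the subspace topology induced by Inf; its carrier is
   [nat -> X].  In particular this is not the product topology. *)
Definition iword (X : topologicalType) : topologicalType :=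
  initial_topology (@Inf X).

Section Products.
Variable X : topologicalType.

Definition word_atom (A : set (seq X)) : Prop :=
  (exists2 C : set X, irreducible_closed C & A = lang_opt C) \/
  (exists2 F : set X, closed F & A = lang_star F).

Definition word_product (P : set (seq X)) : Prop :=
  exists2 As : seq (set (seq X)), {in As, forall A, word_atom A} &
    P = foldr (@lang_cat X) [set [::]] As.

Definition finite_or_infinite_word_product (L : set (fiword X)) : Prop :=
  exists P F, [/\ word_product P, closed F &
    L = [set catw u w | u in P & w in lang_leomega F]].

Definition infinite_word_product (L : set (iword X)) : Prop :=
  exists P F, [/\ word_product P, closed F, F !=set0 &
    L = [set prepend u f | u in P & f in lang_omega F]].

End Products.

(* Main.v *)
Require Import Defs.
From mathcomp Require Import all_boot all_order.
From mathcomp Require Import all_classical topology finmap.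
From Stdlib Require Import Relation_Operators Wellfounded.

(* Finite words.  A language [L] of finite words is irreducible closed for the
   subword topology when it is [directed] and [subword_closed].  Word products
   have both properties, atom by atom.  Conversely, if [L] is such and [L] is
   strictly inside a product [P], some [Us] is a subword of a word of [P] but
   of no word of [L]; the words of [P] avoiding [Us] are covered by finitely
   many products obtained from [P] by replacing atoms with lists of smaller
   atoms, and directedness puts [L] inside one of them.  This multiset descent
   terminates because inclusion of closed sets is well-founded.

   Infinite words.  Since <U_1; ...; U_n; (oo) U> is the intersection of
   <U_1; ...; U_n> and <(oo) U>, an irreducible closed [C] is determined by
   which of these sets it meets.  Let [F] be the least closed set such that
   the words of [C] eventually stay in [F], and [Q] the set of finite words
   in [C]; then [Q F^* = Q] and [C = Q F^{<=omega}], so the finite case applies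
   to [Q].  For [X^omega], pass to the closure in [X^{<=omega}]. *)

Set Implicit Arguments.
Unset Strict Implicit.
Unset Printing Implicit Defensive.

Local Open Scope classical_set_scope.

(** * Word products of finite words *)

Section FiniteWords.
Variable X : topologicalType.
Implicit Types (U C F : set X) (Us Vs : seq (set X)) (u v w : seq X).
Implicit Types (L A B : set (seq X)) (Uss : seq (seq (set X))).

(** Finite-word form of <U_1; ...; U_n>, recursive on the word so that inductions on words compute;
    [subword_set_Fin] identifies the two. *)
Fixpoint emb Us u {struct u} : Prop :=
  match Us, u with
  | [::], _ => True
  | _, [::] => False
  | U :: Us', x :: u' => (U x /\ emb Us' u') \/ emb Us u'
  end.

Lemma emb0 u : emb [::] u. Proof. by case: u. Qed.

Lemma emb_catl Us u v : emb Us v -> emb Us (u ++ v).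
Proof. by elim: u => [//|x u IH] /IH; case: Us {IH} => //; right. Qed.

Lemma emb_cat Us Vs u v : emb Us u -> emb Vs v -> emb (Us ++ Vs) (u ++ v).
Proof.
elim: u Us => [|x u IH] [|U Us] //=.
- by move=> _; exact: (@emb_catl Vs (x :: u)).
- case=> [[Ux uUs]|uUs] vVs; first by left; split=> //; exact: IH.
  by right; exact: (IH (U :: Us)).
Qed.

Lemma emb_catr Us u v : emb Us u -> emb Us (u ++ v).
Proof. by move=> /emb_cat /(_ (emb0 v)); rewrite cats0. Qed.

Lemma emb_split Us u v : emb Us (u ++ v) ->
  exists Us1 Us2, [/\ Us = Us1 ++ Us2, emb Us1 u & emb Us2 v].
Proof.
elim: u Us => [|x u IH] Us.
  by exists [::], Us.
case: Us => [_|U Us /=]; first by exists [::], [::]; split=> //; exact: emb0.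
case=> [[Ux /IH[Us1 [Us2 [-> ? ?]]]]|/IH[[|U1 Us1] [Us2 [/= eqUs ? ?]]]].
- by exists (U :: Us1), Us2; split=> //; left.
- by exists [::], Us2; split.
- by exists (U1 :: Us1), Us2; split=> //; right.
Qed.

Lemma emb_behead U Us u : emb (U :: Us) u -> emb Us u.
Proof.
elim: u => [//|x u IH] /= [[_ uUs]|/IH uUs]; exact: (@emb_catl Us [:: x]).
Qed.

Lemma emb_drop Us U u v : (forall x, x \in u -> ~ U x) ->
  emb (U :: Us) (u ++ v) -> emb (U :: Us) v.
Proof.
elim: u => [//|x u IH] nU /= [[Ux]|]; first by case: (nU x); rewrite ?mem_head.
by apply: IH => y uy; apply: nU; rewrite inE uy orbT.
Qed.

Definition opens Us : Prop := {in Us, forall U, open U}.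

Lemma forall_in_cons (T : eqType) (P : T -> Prop) (x : T) (s : seq T) :
  {in x :: s, forall y, P y} <-> P x /\ {in s, forall y, P y}.
Proof.
split=> [Ps|[Px Ps] y]; last by rewrite inE => /predU1P[->|/Ps].
by split=> [|y sy]; apply: Ps; rewrite inE ?eqxx ?sy ?orbT.
Qed.

Lemma forall_in_cat (T : eqType) (P : T -> Prop) (s t : seq T) :
  {in s ++ t, forall y, P y} <-> {in s, forall y, P y} /\ {in t, forall y, P y}.
Proof.
split=> [Pst|[Ps Pt] y]; last by rewrite mem_cat => /orP[/Ps|/Pt].
by split=> y sy; apply: Pst; rewrite mem_cat sy ?orbT.
Qed.

Lemma opens_cons U Us : opens (U :: Us) <-> open U /\ opens Us.
Proof. exact: forall_in_cons. Qed.

Lemma opens_cat Us Vs : opens (Us ++ Vs) <-> opens Us /\ opens Vs.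
Proof. exact: forall_in_cat. Qed.

Definition meets L Us : Prop := exists2 u, L u & emb Us u.

(** The sets <U_1; ...; U_n> form a base of the subword topology on finite words, so closedness can
    be tested on single lists [Us]. *)
Definition subword_closed L : Prop :=
  forall w, (forall Us, opens Us -> emb Us w -> meets L Us) -> L w.

(** Irreducibility phrased on basic opens; the empty family [Uss] makes [L] inhabited. *)
Definition directed L : Prop :=
  forall Uss, {in Uss, forall Us, opens Us /\ meets L Us} ->
  exists2 u, L u & {in Uss, forall Us, emb Us u}.

Definition prod_lang (As : seq (set (seq X))) : set (seq X) :=
  foldr (@lang_cat X) [set [::]] As.

Definition atoms (As : seq (set (seq X))) : Prop :=
  {in As, forall A, word_atom A}.

Lemma atoms_cons A As : atoms (A :: As) <-> word_atom A /\ atoms As.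
Proof. exact: forall_in_cons. Qed.

Lemma atoms_cat As Bs : atoms (As ++ Bs) <-> atoms As /\ atoms Bs.
Proof. exact: forall_in_cat. Qed.

Lemma atom_nil A : word_atom A -> A [::].
Proof. by move=> [[C _ ->]|[F _ ->]] //; split. Qed.

Lemma prod_nil As : atoms As -> prod_lang As [::].
Proof.
elim: As => [//|A As IH] /atoms_cons[/atom_nil A0 /IH As0].
by exists [::] => //; exists [::].
Qed.

Lemma prod_lang_cat As Bs : 
  prod_lang (As ++ Bs) = lang_cat (prod_lang As) (prod_lang Bs).
Proof.
elim: As => [|A As IH] /=.
  apply/seteqP; split=> [u Bu|_ [_ -> [v Bv <-]]] //.
  by exists [::] => //; exists u.
rewrite IH; apply/seteqP; split.
  move=> _ [u Au [_ [v Asv [w Bw <-]] <-]].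
  by exists (u ++ v); [exists u => //; exists v|exists w => //; rewrite catA].
move=> _ [_ [u Au [v Asv <-]] [w Bw <-]].
by exists u => //; exists (v ++ w); rewrite ?catA//; exists v => //; exists w.
Qed.

(** * Directedness of word products *)

Lemma open_bigcap_seq (T : topologicalType) (Os : seq (set T)) :
  {in Os, forall W, open W} -> open (\bigcap_(W in [set` Os]) W).
Proof.
rewrite bigcap_seq; elim: Os => [_|V Os IH oOs]; rewrite ?big_nil ?big_cons.
  exact: openT.
apply: openI; first by apply: oOs; rewrite mem_head.
by apply: IH => Z OZ; apply: oOs; rewrite inE OZ orbT.
Qed.

(** If [D] missed the intersection of [U] with the meet [W] of the other opens, the complements of
    [U] and [W] would cover [D], so one of them would contain it. *)
Lemma irreducible_meetsI (T : topologicalType) (D : set T) (Os : seq (set T)) :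
  irreducible_set D ->
  {in Os, forall W, open W /\ exists2 x, D x & W x} ->
  exists2 x, D x & {in Os, forall W, W x}.
Proof.
move=> [[c Dc] irrD]; elim: Os => [|U Os IH] H; first by exists c.
case: IH => [V OV|x Dx Osx]; first by apply: H; rewrite inE OV orbT.
have [oU [y Dy Uy]] := H _ (mem_head _ _).
pose W := \bigcap_(V in [set` Os]) V.
have oW : open W.
  apply: open_bigcap_seq => V OV.
  by have [] := H V; rewrite ?inE ?OV ?orbT.
case: (pselect (exists2 z, D z & U z /\ W z)) => [[z Dz [Uz Wz]]|nz].
  exists z => // V; rewrite inE => /predU1P[->//|OV]; exact: Wz.
case: (irrD (~` U) (~` W)); rewrite ?closedC//.
- move=> z Dz; apply: contrapT => /not_orP[/contrapT Uz /contrapT Wz].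
  by apply: nz; exists z.
- by move=> /(_ _ Dy).
- by move=> /(_ _ Dx) []; move=> V OV; apply: Osx.
Qed.

(** A word of length at most one matches at most one open, so one letter of [C] has to hit all the
    opens occurring in [Uss]. *)
Lemma directed_opt C : irreducible_set C -> directed (lang_opt C).
Proof.
move=> irrC Uss H.
pose heads := flatten Uss.
have [|x Cx xU] := irreducible_meetsI (Os := heads) irrC.
  move=> U /flattenP[Us UssUs UsU]; have [oUs [u [su uC] uUs]] := H _ UssUs.
  split; first exact: oUs.
  case: u su uC uUs => [|y [|//]] _ uC; first by case: Us UsU {UssUs oUs}.
  case: Us UsU {UssUs oUs} => [//|V [|W Us]] /=; last by move=> _ [[_ []]|[]].
  rewrite inE => /eqP -> [[Vy _]|[]//].
  by exists y => //; apply: uC; rewrite mem_head.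
exists [:: x].
  by split=> // y; rewrite inE => /eqP ->.
move=> Us UssUs; have [_ [u [su uC] uUs]] := H _ UssUs.
have {}xU : {in Us, forall U, U x}.
  by move=> U UsU; apply: xU; apply/flattenP; exists Us.
case: Us uUs xU {UssUs} => [//|V [|W Us]].
  by move=> _ /(_ _ (mem_head _ _)); left.
case: u su {uC} => [//|y [|//]] _ /=; by move=> [[_ []]|[]].
Qed.

(** The witnesses for the several lists are concatenated. *)
Lemma directed_star F : directed (lang_star F).
Proof.
elim=> [_|Us Uss IH H]; first by exists [::].
case: IH => [V VU|v Fv vUss]; first by apply: H; rewrite inE VU orbT.
have [_ [u Fu uUs]] := H _ (mem_head _ _).
exists (u ++ v); first by move=> x; rewrite mem_cat => /orP[/Fu|/Fv].
move=> V; rewrite inE => /predU1P[->|/vUss]; [exact: emb_catr|exact: emb_catl].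
Qed.

(** Each list of [Uss] is cut where its witness passes from [A] to [B]; the two families of pieces
    are then treated separately. *)
Lemma directed_cat A B : directed A -> directed B -> directed (lang_cat A B).
Proof.
move=> dA dB Uss H.
pose splits (Vss Wss : seq (seq (set X))) :=
  [/\ {in Vss, forall Us, opens Us /\ meets A Us},
      {in Wss, forall Us, opens Us /\ meets B Us} &
      {in Uss, forall Us, exists Vs Ws,
        [/\ Us = Vs ++ Ws, Vs \in Vss & Ws \in Wss]}].
suff [Vss [Wss [HV HW HU]]] : exists Vss Wss, splits Vss Wss.
  have [a Aa aV] := dA _ HV; have [b Bb bW] := dB _ HW.
  exists (a ++ b); first by exists a => //; exists b.
  by move=> Us /HU[Vs [Ws [-> /aV ? /bW ?]]]; exact: emb_cat.
rewrite /splits {splits}; elim: Uss H => [_|Us Uss IH H].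
  by exists [::], [::].
have [V|Vss [Wss [HV HW HU]]] := IH.
  by move=> UssV; apply: H; rewrite inE UssV orbT.
have [oUs [_ [a Aa [b Bb <-]] /emb_split[Vs [Ws [eqUs aV bW]]]]] :=
  H _ (mem_head _ _).
move: oUs; rewrite eqUs => /opens_cat[oV oW].
exists (Vs :: Vss), (Ws :: Wss); split.
- move=> Z; rewrite inE => /predU1P[->|/HV//]; split=> //; by exists a.
- move=> Z; rewrite inE => /predU1P[->|/HW//]; split=> //; by exists b.
- move=> Z; rewrite inE => /predU1P[->|/HU[Vs' [Ws' [-> VV WW]]]].
    by exists Vs, Ws; rewrite !mem_head.
  by exists Vs', Ws'; rewrite !inE VV WW !orbT.
Qed.

Lemma directed_prod As : atoms As -> directed (prod_lang As).
Proof.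
elim: As => [_|A As IH /atoms_cons[atA /IH dAs]] /=.
  by move=> Uss H; exists [::] => // Us /H[_ [_ ->]].
apply: directed_cat => //.
case: atA => [[C [_ irrC] ->]|[F _ ->]]; first exact: directed_opt.
exact: directed_star.
Qed.

(** * Closedness of word products *)

Fixpoint pointwise Us u : Prop :=
  match Us, u with
  | [::], [::] => True
  | U :: Us', x :: u' => U x /\ pointwise Us' u'
  | _, _ => False
  end.

Lemma pointwise_emb Us u : pointwise Us u -> emb Us u.
Proof.
by elim: Us u => [|U Us IH] [|x u] //= [Ux /IH uUs]; left.
Qed.

(* A word outside a product is separated from it by a list of opens of the
   same length; this alignment makes it possible to shrink the first open. *)
Definition separated L : Prop :=
  forall w, ~ L w -> exists Us, [/\ opens Us, pointwise Us w & ~ meets L Us].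

Lemma separated_closed L : separated L -> subword_closed L.
Proof.
move=> sL w H; apply: contrapT => /sL[Us [oUs /pointwise_emb wUs]]; apply.
exact: H.
Qed.

Lemma separated_nil : separated [set [::]].
Proof.
move=> w nw; exists (nseq (size w) setT); split.
- by move=> U /nseqP[-> _]; exact: openT.
- by elim: w {nw} => //= x w IH.
- by case: w nw => [[]|x w _ [_ ->]].
Qed.

Lemma not_meets_cat U Us A B :
  (forall a, A a -> forall x, x \in a -> ~ U x) ->
  ~ meets B (U :: Us) -> ~ meets (lang_cat A B) (U :: Us).
Proof.
move=> nAU nB [_ [a Aa [b Bb <-]] abU]; apply: nB; exists b => //.
by apply: emb_drop abU => x; exact: nAU.
Qed.

Lemma open_setD U F : open U -> closed F -> open (U `\` F).
Proof. by move=> oU cF; rewrite setDE; apply: openI; rewrite ?openC. Qed.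

(** If the first letter lies in [C], the tail is separated from [B] and [setT] is put in front.
    Otherwise the whole word is separated from [B] and the first open is shrunk to miss [C], so that
    the option cannot match it. *)
Lemma separated_opt C B : closed C -> B [::] -> separated B ->
  separated (lang_cat (lang_opt C) B).
Proof.
move=> cC B0 sB [|x v] nw.
  by case: nw; exists [::] => //; exists [::].
case: (pselect (C x)) => [Cx|nCx].
  have [|Us [oUs vUs nBUs]] := sB v.
    move=> Bv; apply: nw; exists [:: x]; last by exists v.
    by split=> // y; rewrite inE => /eqP ->.
  exists (setT :: Us); split=> //.
    by apply/opens_cons; split=> //; exact: openT.
  move=> [_ [[|c [|c' a]] [// _ _] [b Bb <-]] bUs]; apply: nBUs; exists b => //.
    exact: emb_behead bUs.
  by case: bUs => [[_ //]|/emb_behead].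
have [|[|U Us] [oUs //= [Ux vUs] nBUs]] := sB (x :: v).
  by move=> Bw; apply: nw; exists [::] => //; exists (x :: v).
move/opens_cons: oUs => [oU oUs].
exists (U `\` C :: Us); split=> //.
  by apply/opens_cons; split=> //; exact: open_setD.
apply: not_meets_cat => [a [_ aC] y /aC Cy []//|[b Bb bUs]].
apply: nBUs; exists b => //; elim: {Bb} b bUs => //= y b IH [[[Uy _] ?]|/IH];
  by [left|right].
Qed.

(** As for an option, except that after a first letter in [F] the tail must again be separated from
    the full concatenation, whence the induction on the word. *)
Lemma separated_star F B : closed F -> B [::] -> separated B ->
  separated (lang_cat (lang_star F) B).
Proof.
move=> cF B0 sB w; elim: w => [|x v IH] nw.
  by case: nw; exists [::] => //; exists [::].
case: (pselect (F x)) => [Fx|nFx].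
  have [|Us [oUs vUs nUs]] := IH.
    move=> [f Ff [b Bb fb]]; apply: nw; exists (x :: f).
      by move=> y; rewrite inE => /predU1P[->|/Ff].
    by exists b => //; rewrite -fb.
  exists (setT :: Us); split=> //.
    by apply/opens_cons; split=> //; exact: openT.
  by move=> [u Lu /emb_behead uUs]; apply: nUs; exists u.
have [|[|U Us] [oUs //= [Ux vUs] nBUs]] := sB (x :: v).
  by move=> Bw; apply: nw; exists [::] => //; exists (x :: v).
move/opens_cons: oUs => [oU oUs].
exists (U `\` F :: Us); split=> //.
  by apply/opens_cons; split=> //; exact: open_setD.
apply: not_meets_cat => [a aF y /aF Fy []//|[b Bb bUs]].
apply: nBUs; exists b => //; elim: {Bb} b bUs => //= y b IH' [[[Uy _] ?]|/IH'];
  by [left|right].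
Qed.

Lemma closed_prod As : atoms As -> subword_closed (prod_lang As).
Proof.
move=> atAs; apply: separated_closed.
elim: As atAs => [_|A As IH /atoms_cons[atA atAs]] /=.
  exact: separated_nil.
have As0 := prod_nil atAs; have sAs := IH atAs.
case: atA => [[C [cC _] ->]|[F cF ->]];
  [exact: separated_opt|exact: separated_star].
Qed.

End FiniteWords.

(** * Irreducible closed languages of finite words *)

Section Noetherian.
Variable X : topologicalType.
Hypothesis noethX : noetherian X.
Implicit Types (U C F G : set X) (Us Vs : seq (set X)) (u v w : seq X).
Implicit Types (A B : set (seq X)) (P Q As Bs : seq (set (seq X))).

(** Compactness of the union [U] of the complements, through cluster points: the traces of the [F n]
    on [U] generate a proper filter, yet each point of [U] has the complement of some [F n] as a
    neighbourhood. *)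
Lemma closed_chain_stops (F : nat -> set X) :
  (forall n, closed (F n)) -> (forall n, F n.+1 `<` F n) -> False.
Proof.
move=> cF ltF.
have decF m n : (m <= n)%N -> F n `<=` F m.
  elim: n => [|n IH]; first by rewrite leqn0 => /eqP->.
  rewrite leq_eqVlt => /predU1P[->//|/IH FnFm].
  exact: subset_trans (ltF n).1 FnFm.
pose U := \bigcup_n ~` F n.
have oU : open U by apply: bigcup_open => n _; rewrite openC.
have filt : ProperFilter (filter_from setT (fun n => U `&` F n)).
  apply: filter_from_proper => [|n _].
    apply: filter_from_filter => [|m n _ _]; first by exists 0%N.
    exists (maxn m n) => // x [Ux Fx].
    by split; split=> //; apply: decF Fx; rewrite ?leq_maxl ?leq_maxr.
  have [x [Fx nFx]] : exists x, F n x /\ ~ F n.+1 x.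
    apply: contrapT => H; case: (ltF n) => _; apply=> x Fx.
    by apply: contrapT => nFx; apply: H; exists x.
  by exists x; split=> //; exists n.+1.
have [|x [[n _ nFx] clx]] := noethX oU filt.
  by exists 0%N => // x [].
have [y [[_ Fny] nFny]] : (U `&` F n) `&` (~` F n) !=set0.
  by apply: clx; [exists n|apply: open_nbhs_nbhs; split; rewrite ?openC].
exact: nFny.
Qed.

(** With closedness inside the relation, every set is accessible: one that is not closed has no
    predecessor. *)
Definition closed_lt F G := [/\ closed F, closed G & F `<` G].

Lemma closed_lt_wf F : Acc closed_lt F.
Proof.
apply: contrapT => nF.
have step (G : {G | ~ Acc closed_lt G}) :
    {H : {G | ~ Acc closed_lt G} | closed_lt (sval H) (sval G)}.
  apply: cid; case: G => G nG; apply: contrapT => H; case: (nG).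
  split=> K KG; apply: contrapT => nK; apply: H.
  by exists (exist _ K nK).
have [f [_ fS]] := dependent_choice step (exist _ F nF).
apply: (@closed_chain_stops (fun n => sval (f n))) => n; by case: (fS n).
Qed.

(** Noetherian induction: a non-empty reducible [F] is covered by two closed sets on which its
    traces are strictly smaller. *)
Lemma irreducible_components F : closed F -> exists2 Cs : seq (set X),
  {in Cs, forall C, irreducible_closed C /\ C `<=` F} &
  forall x, F x -> exists2 C, C \in Cs & C x.
Proof.
move: F; apply: (well_founded_ind closed_lt_wf) => F IH cF.
case: (pselect (irreducible_set F)) => [irrF|nirr].
  exists [:: F]; first by move=> C; rewrite inE => /eqP ->; split.
  by move=> x Fx; exists F; rewrite ?mem_head.
case: (pselect (F !=set0)) => [F0|F0]; last first.
  by exists [::] => // x Fx; case: F0; exists x.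
have [C1 [C2 [cC1 cC2 F12 [nF1 nF2]]]] : exists C1 C2,
    [/\ closed C1, closed C2, F `<=` C1 `|` C2 & ~ F `<=` C1 /\ ~ F `<=` C2].
  apply: contrapT => H; apply: nirr; split=> // C1 C2 cC1 cC2 F12.
  apply: contrapT => /not_orP nF; apply: H; by exists C1, C2; split.
have half D : closed D -> ~ F `<=` D -> exists2 Cs : seq (set X),
    {in Cs, forall C, irreducible_closed C /\ C `<=` F} &
    forall x, F x -> D x -> exists2 C, C \in Cs & C x.
  move=> cD nFD; have cFD : closed (F `&` D) by exact: closedI.
  have [|//|Cs HCs Cov] := IH (F `&` D).
    by split=> //; split=> // FFD; apply: nFD => x /FFD[].
  exists Cs => [C /HCs[irrC CFD]|x Fx Dx]; last exact: Cov.
  by split=> // x /CFD[].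
have [Cs1 H1 cov1] := half _ cC1 nF1; have [Cs2 H2 cov2] := half _ cC2 nF2.
exists (Cs1 ++ Cs2) => [C|x Fx]; first by rewrite mem_cat => /orP[/H1|/H2].
case: (F12 x Fx) => [/(cov1 _ Fx)[C]|/(cov2 _ Fx)[C]] CC Cx;
  by exists C => //; rewrite mem_cat CC ?orbT.
Qed.

(** * Well-founded orders on atoms and on products *)

Definition atom_lt A B := [/\ word_atom A, word_atom B & A `<` B].

Lemma lang_star_proper F G :
  lang_star F `<` lang_star G -> F `<` G.
Proof.
move=> [FG nGF]; split=> [x Fx|GF].
  apply: (FG [:: x]); last exact: mem_head.
  by move=> y; rewrite inE => /eqP ->.
by apply: nGF => u Gu x /Gu /GF.
Qed.

Lemma lang_opt_proper C D : lang_opt C `<` lang_opt D -> C `<` D.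
Proof.
move=> [CD nDC]; split=> [x Cx|DC].
  have [|_ ] := CD [:: x]; last by apply; exact: mem_head.
  by split=> // y; rewrite inE => /eqP ->.
by apply: nDC => u [su Du]; split=> // x /Du /DC.
Qed.

(** Options come first: a star strictly below an option contains only the empty word, since one
    letter would give words of length two. Below a star lie options, already accessible, and stars
    over smaller closed sets. *)
Lemma atom_lt_wf A : word_atom A -> Acc atom_lt A.
Proof.
have accE : Acc atom_lt [set [::]].
  split=> B [atB _ [_]]; case=> _ ->; exact: atom_nil.
have accO C : closed C -> Acc atom_lt (lang_opt C).
  move: C; apply: (well_founded_ind closed_lt_wf) => C IH cC.
  split=> _ [[[D [cD _] ->]|[F cF ->]] _ ltC].
    by apply: IH => //; split=> //; exact: lang_opt_proper.
  suff -> : lang_star F = [set [::]] by [].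
  apply/seteqP; split=> [[//|x u] Fxu|_ ->//].
  have [|//] := ltC.1 [:: x; x].
  by move=> y; rewrite !inE => /orP[] /eqP ->; apply: Fxu; rewrite mem_head.
move=> [[C [cC _] ->]|]; first exact: accO.
move=> [F cF ->]; move: F cF; apply: (well_founded_ind closed_lt_wf) => F IH cF.
split=> _ [[[D [cD _] ->]|[G cG ->]] _ ltF]; first exact: accO.
by apply: IH => //; split=> //; exact: lang_star_proper.
Qed.

(* A step of the multiset (Dershowitz-Manna) order on the atoms. *)
Definition prod_step Q P : Prop := exists l A r Bs,
  [/\ P = l ++ A :: r, Q = l ++ Bs ++ r & {in Bs, forall B, atom_lt B A}].

Definition prod_lt := clos_trans _ prod_step.

Definition prod_le Q P : Prop := Q = P \/ prod_lt Q P.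

Lemma cat_eq_cat_cons (T : Type) (s1 s2 l r : seq T) (a : T) :
  s1 ++ s2 = l ++ a :: r ->
  (exists t, s1 = l ++ a :: t /\ r = t ++ s2) \/
  (exists t, s2 = t ++ a :: r /\ l = s1 ++ t).
Proof.
elim: s1 l => [|b s1 IH] l /= E; first by right; exists l.
case: l E => [|c l] /= [-> E]; first by left; exists s1.
by case: (IH _ E) => [] [t [-> ->]]; [left|right]; exists t.
Qed.

(** Nested induction on the two accessibility proofs: a step from [P ++ Q] replaces an atom of [P]
    or an atom of [Q]. *)
Lemma prod_step_acc_cat P Q :
  Acc prod_step P -> Acc prod_step Q -> Acc prod_step (P ++ Q).
Proof.
move=> accP; elim: accP Q => {}P accP IHP Q accQ.
elim: accQ => {}Q accQ IHQ.
split=> S [l [A [r [Bs [E -> ltBs]]]]]; have {}E := cat_eq_cat_cons E.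
case: E => [] [t [? ?]]; subst.
  have -> : l ++ Bs ++ t ++ Q = (l ++ Bs ++ t) ++ Q by rewrite -!catA.
  by apply: IHP; [exists l, A, t, Bs|split].
rewrite -catA; apply: IHQ; by exists t, A, r, Bs.
Qed.

(** Concatenation reduces the claim to one-atom lists; a step from [[:: A]] gives a list of smaller
    atoms, each accessible by induction on [A]. *)
Lemma prod_step_acc P : atoms P -> Acc prod_step P.
Proof.
have acc0 : Acc prod_step [::] by split=> Q [[|? ?] [A [r [Bs []]]]].
have acc_list Q : {in Q, forall A, Acc prod_step [:: A]} -> Acc prod_step Q.
  elim: Q => [//|A Q IH] H; apply: (@prod_step_acc_cat [:: A]).
    by apply: H; rewrite mem_head.
  by apply: IH => B QB; apply: H; rewrite inE QB orbT.
move=> atP; apply: (acc_list) => A /atP /atom_lt_wf; elim=> {}A _ IH.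
split=> Q [l [B [r [Bs [eqA -> ltBs]]]]].
have [-> -> eqB] : [/\ l = [::], r = [::] & A = B].
  case: l eqA => [|D l] /= E; first by case: E => -> <-.
  by case: E => _; case: l.
by rewrite cats0; apply: acc_list => C /ltBs; rewrite -eqB; exact: IH.
Qed.

Lemma prod_lt_acc P : atoms P -> Acc prod_lt P.
Proof. by move=> /prod_step_acc; exact: Acc_clos_trans. Qed.

Lemma prod_lt_catl l Q P : prod_lt Q P -> prod_lt (l ++ Q) (l ++ P).
Proof.
elim=> {Q P} [Q P [l' [A [r [Bs [-> -> ltBs]]]]]|Q P S _ IH1 _ IH2].
  by apply: t_step; exists (l ++ l'), A, r, Bs; rewrite -!catA.
exact: t_trans IH1 IH2.
Qed.

Lemma prod_lt_cons Bs A Q P : {in Bs, forall B, atom_lt B A} ->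
  prod_le Q P -> prod_lt (Bs ++ Q) (A :: P).
Proof.
move=> ltBs leQ; have lt1 : prod_lt (Bs ++ P) (A :: P).
  by apply: t_step; exists [::], A, P, Bs.
by case: leQ => [->//|/(@prod_lt_catl Bs) lt2]; exact: t_trans lt2 lt1.
Qed.

Lemma prod_lt_atoms Q P : prod_lt Q P -> atoms P -> atoms Q.
Proof.
elim=> {Q P} [Q P [l [A [r [Bs [-> -> ltBs]]]]]|Q P S _ IH1 _ IH2];
  last by auto.
rewrite !atoms_cat atoms_cons => -[atl [_ atr]]; split=> //; split=> //.
by move=> B /ltBs[].
Qed.

(** * Finite covers by smaller products *)

Definition covered (W : set (seq X)) (D : set (seq (set (seq X)))) : Prop :=
  exists2 Qs : seq (seq (set (seq X))),
    {in Qs, forall Q, D Q} &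
    forall u, W u -> exists2 Q, Q \in Qs & prod_lang Q u.

Lemma covered0 D : covered set0 D. Proof. by exists [::]. Qed.

Lemma covered1 W (D : set (seq (set (seq X)))) Q :
  D Q -> W `<=` prod_lang Q -> covered W D.
Proof.
move=> DQ WQ; exists [:: Q]; first by move=> Q'; rewrite inE => /eqP ->.
by move=> u /WQ; exists Q => //; rewrite mem_head.
Qed.

Lemma coveredU (W W' : set (seq X)) D :
  covered W D -> covered W' D -> covered (W `|` W') D.
Proof.
move=> [Qs DQ cov] [Qs' DQ' cov']; exists (Qs ++ Qs').
  by move=> Q; rewrite mem_cat => /orP[/DQ|/DQ'].
move=> u [/cov|/cov'] [Q QQ Qu]; by exists Q => //; rewrite mem_cat QQ ?orbT.
Qed.

Lemma covered_sub (W W' : set (seq X)) D :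
  W `<=` W' -> covered W' D -> covered W D.
Proof. by move=> WW' [Qs DQ cov]; exists Qs => // u /WW' /cov. Qed.

Lemma covered_bigU (I : choiceType) (s : seq I) (W : I -> set (seq X)) D :
  {in s, forall i, covered (W i) D} ->
  covered (\bigcup_(i in [set` s]) W i) D.
Proof.
elim: s => [_|i s IH H]; first by rewrite set_nil bigcup_set0; exact: covered0.
rewrite bigcup_seq big_cons -bigcup_seq; apply: coveredU.
  by apply: H; rewrite mem_head.
by apply: IH => j sj; apply: H; rewrite inE sj orbT.
Qed.

Lemma covered_cat l (W : set (seq X)) (D D' : set (seq (set (seq X)))) :
  (forall Q, D Q -> D' (l ++ Q)) -> covered W D ->
  covered (lang_cat (prod_lang l) W) D'.
Proof.
move=> DD' [Qs DQ cov]; exists (map (cat l) Qs).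
  by move=> _ /mapP[Q /DQ /DD' ? ->].
move=> _ [u lu [v /cov[Q QQ Qv] <-]]; exists (l ++ Q); first exact: map_f.
by rewrite prod_lang_cat; exists u => //; exists v.
Qed.

Lemma prod_lang1 A : prod_lang [:: A] = A.
Proof.
apply/seteqP; split=> [_ [u Au [_ -> <-]]|u Au]; first by rewrite cats0.
by exists u => //; exists [::]; rewrite ?cats0.
Qed.

Lemma covered_cons A (W : set (seq X)) (D D' : set (seq (set (seq X)))) :
  (forall Q, D Q -> D' (A :: Q)) -> covered W D -> covered (lang_cat A W) D'.
Proof. by rewrite -{2}(prod_lang1 A); exact: covered_cat. Qed.

Definition avoid (L : set (seq X)) Us : set (seq X) :=
  [set u | L u /\ ~ emb Us u].

(** Quantified over all [Us] because the induction on [P] also calls for shorter lists, once the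
    first atom has matched an open. *)
Definition shrinks P : Prop := forall Us, opens Us -> meets (prod_lang P) Us ->
  covered (avoid (prod_lang P) Us) (prod_lt^~ P).

(** When the product does not meet [Us] it is kept as it is, hence the weak order. *)
Lemma shrinks_le P Us : shrinks P -> opens Us ->
  covered (avoid (prod_lang P) Us) (prod_le^~ P).
Proof.
move=> shP oUs; case: (pselect (meets (prod_lang P) Us)) => [m|nm].
  have [Qs DQ cov] := shP _ oUs m; by exists Qs => // Q /DQ; right.
by apply: (covered1 (Q := P)); [left|move=> u []].
Qed.

Lemma star_setD_lt F U : closed F -> open U -> (exists2 x, F x & U x) ->
  atom_lt (lang_star (F `\` U)) (lang_star F).
Proof.
move=> cF oU [x Fx Ux]; split; last split.
- right; exists (F `\` U) => //.
  by rewrite setDE; apply: closedI; rewrite ?closedC.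
- by right; exists F.
- by move=> u uF y /uF[].
have Fx1 : lang_star F [:: x] by move=> y; rewrite inE => /eqP ->.
by move=> /(_ _ Fx1 x (mem_head _ _)) [].
Qed.

(** Strictness is witnessed by a word of length two, too long for the option. *)
Lemma opt_star_lt C F : closed F -> irreducible_closed C -> C `<=` F ->
  atom_lt (lang_opt C) (lang_star F).
Proof.
move=> cF irrC CF; split; [by left; exists C|by right; exists F|].
split=> [u [_ uC] x /uC /CF//|]; have [_ [[c Cc] _]] := irrC.
have Fcc : lang_star F [:: c; c].
  by move=> y; rewrite !inE orbb => /eqP ->; exact: CF.
by move=> /(_ _ Fcc) [].
Qed.

Lemma opt_setD_lt C U D : irreducible_closed C -> (exists2 x, C x & U x) ->
  irreducible_closed D -> D `<=` C `\` U -> atom_lt (lang_opt D) (lang_opt C).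
Proof.
move=> irrC [x Cx Ux] irrD DC; split; [by left; exists D|by left; exists C|].
split=> [u [su uD]|]; first by split=> // y /uD /DC[].
have Cx1 : lang_opt C [:: x] by split=> // y; rewrite inE => /eqP ->.
by move=> /(_ _ Cx1) [_ /(_ x (mem_head _ _))] /DC[].
Qed.

(** If [C] misses [U], the whole list has to be matched by [P], and the decrease takes place there.
    Otherwise the avoiding words are sorted by their first letter. *)
Lemma shrinks_opt C P : irreducible_closed C -> shrinks P ->
  shrinks (lang_opt C :: P).
Proof.
move=> irrC shP [|U Us] oUs mUs.
  by apply: covered_sub (covered0 _) => u [_] []; exact: emb0.
have [oU oUs'] := (opens_cons U Us).1 oUs.
case: (pselect (exists2 x, C x & U x)) => [CU|nCU]; last first.
  have mP : meets (prod_lang P) (U :: Us).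
    have [_ [a [_ aC] [v Pv <-]] avU] := mUs; exists v => //.
    by apply: emb_drop avU => x /aC Cx Ux; apply: nCU; exists x.
  apply: (@covered_sub _
    (lang_cat (lang_opt C) (avoid (prod_lang P) (U :: Us)))).
    move=> _ [[a Ca [v Pv <-]] navU]; exists a => //; exists v => //.
    by split=> // vU; apply: navU; exact: emb_catl.
  by apply: covered_cons (shP _ oUs mP) => Q; exact: (@prod_lt_catl [:: _]).
have mP : meets (prod_lang P) Us.
  have [_ [[|c [|c' a]] [// _ _] [v Pv <-]] avU] := mUs; exists v => //.
    exact: emb_behead avU.
  by case: avU => [[]|/emb_behead].
have cCU : closed (C `\` U).
  by rewrite setDE; apply: closedI; [case: irrC|rewrite closedC].
have [Ds HDs covD] := irreducible_components cCU.
pose R := avoid (prod_lang P) (U :: Us).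
pose W := lang_cat (lang_opt C) (avoid (prod_lang P) Us).
(* Three pieces: a first letter in [U], after which the tail avoids [Us]; no letter from the option;
   a letter in a component [D] of [C] outside [U]. In the last two the tail need not decrease: the
   strict decrease comes from deleting the option or shrinking it to [D]. *)
apply: (@covered_sub _ (W `|` (R `|`
    \bigcup_(D in [set` Ds]) lang_cat (lang_opt D) R))).
  move=> _ [[[|c [|c' a]] [// _ aC] [v Pv <-]] navU]; first by right; left.
  case: (pselect (U c)) => Uc.
    left; exists [:: c] => //; exists v => //; split=> // vUs; apply: navU.
    by left.
  right; right; have [|D DD Dc] := covD c.
    by split=> //; apply: aC; rewrite mem_head.
  exists D => //; exists [:: c].
    by split=> // y; rewrite inE => /eqP ->.
  by exists v => //; split=> // vUs; apply: navU; right.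
have covR := shrinks_le shP oUs.
apply: coveredU; last apply: coveredU.
- by apply: covered_cons (shP _ oUs' mP) => Q; exact: (@prod_lt_catl [:: _]).
- have [Qs DQ cov] := covR.
  by exists Qs => // Q /DQ leQ; exact: (@prod_lt_cons [::]).
- apply: covered_bigU => D /HDs[irrD DCU]; apply: covered_cons covR => Q leQ.
  apply: (@prod_lt_cons [:: _]) leQ => B; rewrite inE => /eqP ->.
  exact: opt_setD_lt irrC CU irrD DCU.
Qed.

Lemma split_first U u : (exists2 x, x \in u & U x) ->
  exists u1 x u2, [/\ u = u1 ++ x :: u2, forall y, y \in u1 -> ~ U y & U x].
Proof.
elim: u => [[x]//|y u IH [x]].
case: (pselect (U y)) => [Uy _ _|nUy]; first by exists [::], y, u.
rewrite inE => /predU1P[->//|ux Ux].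
have [|u1 [z [u2 [-> nU Uz]]]] := IH; first by exists x.
exists (y :: u1), z, u2; split=> // t.
by rewrite inE => /predU1P[->//|]; exact: nU.
Qed.

(** The induction on [Us] must remember how the product decreased: either the star survives, and can
    absorb letters of [F] put in front, or it was traded for smaller atoms. *)
Definition star_shrunk F P Q : Prop :=
  (exists2 Q', Q = lang_star F :: Q' & prod_lt Q' P) \/
  exists Bs Q', [/\ Q = Bs ++ Q', {in Bs, forall B, atom_lt B (lang_star F)}
    & prod_le Q' P].

Lemma star_shrunk_lt F P Q : star_shrunk F P Q -> prod_lt Q (lang_star F :: P).
Proof.
move=> [[Q' -> ltQ]|[Bs [Q' [-> ltBs leQ]]]]; last exact: prod_lt_cons.
exact: (@prod_lt_catl [:: _]).
Qed.

(** Induction on [Us], cutting the star part at its first letter in [U]: earlier letters lie in [F]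
    outside [U], and what follows avoids the shorter list. Without such a letter, the star shrinks
    and the tail avoids [U :: Us]. *)
Lemma star_covered F P Us : closed F -> shrinks P -> opens Us ->
  meets (prod_lang (lang_star F :: P)) Us ->
  covered (avoid (prod_lang (lang_star F :: P)) Us) (star_shrunk F P).
Proof.
move=> cF shP; elim: Us => [|U Us IH] oUs mUs.
  by apply: covered_sub (covered0 _) => u [_] []; exact: emb0.
have [oU oUs'] := (opens_cons U Us).1 oUs.
case: (pselect (exists2 x, F x & U x)) => [FU|nFU]; last first.
  have mP : meets (prod_lang P) (U :: Us).
    have [_ [f fF [v Pv <-]] fvU] := mUs; exists v => //.
    by apply: emb_drop fvU => x /fF Fx Ux; apply: nFU; exists x.
  apply: (@covered_sub _
    (lang_cat (lang_star F) (avoid (prod_lang P) (U :: Us)))).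
    move=> _ [[f Ff [v Pv <-]] nfvU]; exists f => //; exists v => //.
    by split=> // vU; apply: nfvU; exact: emb_catl.
  by apply: covered_cons (shP _ oUs mP) => Q ltQ; left; exists Q.
have [|Qs DQ cov] := IH oUs'.
  by have [w Lw /emb_behead wUs] := mUs; exists w.
pose R := lang_cat (lang_star (F `\` U)) (avoid (prod_lang P) (U :: Us)).
(* [lang_opt F] makes room for the first letter in [U]; it need not be an atom, which the two cases
   below repair. *)
pose W Q :=
  lang_cat (lang_star (F `\` U)) (lang_cat (lang_opt F) (prod_lang Q)).
apply: (@covered_sub _ (R `|` \bigcup_(Q in [set` Qs]) W Q)).
  move=> _ [[f Ff [v Pv <-]] nfvU].
  case: (pselect (exists2 x, x \in f & U x)) => [/split_first|nfU].
    move=> [f1 [x [f2 [eqf nf1 Ux]]]]; right; rewrite eqf in Ff nfvU *.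
    have [|Q QQ Qw] := cov (f2 ++ v).
      split; last first.
        by move=> f2vUs; apply: nfvU; rewrite -catA; apply: emb_catl; left.
      exists f2; last by exists v.
      by move=> y f2y; apply: Ff; rewrite mem_cat inE f2y !orbT.
    exists Q => //; exists f1.
      by move=> y f1y; split; [apply: Ff; rewrite mem_cat f1y|exact: nf1].
    exists ([:: x] ++ (f2 ++ v)); last by rewrite -catA.
    exists [:: x]; last by exists (f2 ++ v).
    split=> // y; rewrite inE => /eqP ->.
    by apply: Ff; rewrite mem_cat mem_head orbT.
  left; exists f.
    by move=> y fy; split; [exact: Ff|move=> Uy; apply: nfU; exists y].
  by exists v => //; split=> // vU; apply: nfvU; exact: emb_catl.
apply: coveredU.
  apply: covered_cons (shrinks_le shP oUs) => Q leQ.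
  right; exists [:: lang_star (F `\` U)], Q; split=> // B.
  by rewrite inE => /eqP ->; exact: star_setD_lt.
apply: covered_bigU => Q /DQ shQ; rewrite /W.
case: (shQ) => [[Q' eqQ ltQ']|[Bs [Q' [eqQ ltBs leQ']]]].
  (* The star at the head of [Q] absorbs the prefix, so [Q] itself covers the piece. *)
  apply: (covered1 (Q := Q)) => // _ [f1 f1F [_ [a [_ aF] [w Qw <-]] <-]].
  move: Qw; rewrite eqQ => -[f fF [v Qv <-]].
  exists (f1 ++ a ++ f); last by exists v => //; rewrite !catA.
  by move=> y; rewrite !mem_cat => /or3P[/f1F[]|/aF|/fF].
(* Here no star remains to absorb the letter: [F] is cut into irreducible components, each giving an
   option strictly below the star. *)
have [Cs HCs covC] := irreducible_components cF.
apply: (@covered_sub _ (lang_cat (lang_star (F `\` U)) (prod_lang Q `|`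
    \bigcup_(C in [set` Cs]) lang_cat (lang_opt C) (prod_lang Q)))).
  move=> _ [f1 f1F [_ [[|c [|c' a]] [// _ aF] [w Qw <-]] <-]].
    by exists f1 => //; exists w => //; left.
  exists f1 => //; exists (c :: w) => //; right.
  have [|C CC Cc] := covC c; first by apply: aF; rewrite mem_head.
  exists C => //; exists [:: c]; last by exists w.
  by split=> // y; rewrite inE => /eqP ->.
pose D := [set S | exists2 Ds : seq (set (seq X)), S = Ds ++ Q' &
   {in Ds, forall B, atom_lt B (lang_star F)}].
apply: (@covered_cons _ _ D).
  move=> _ [Ds -> ltDs]; right; exists (lang_star (F `\` U) :: Ds), Q'.
  split=> // B; rewrite inE => /predU1P[->|/ltDs//]; exact: star_setD_lt.
apply: coveredU; first by apply: (covered1 (Q := Q)) => //; exists Bs.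
apply: covered_bigU => C /HCs[irrC CF].
apply: (covered1 (Q := lang_opt C :: Q)) => //.
exists (lang_opt C :: Bs); first by rewrite eqQ.
by move=> B; rewrite inE => /predU1P[->|/ltBs//]; exact: opt_star_lt.
Qed.

Lemma shrinks_atoms P : atoms P -> shrinks P.
Proof.
elim: P => [_ [|U Us] _|A P IH /atoms_cons[atA /IH shP]].
- by move=> _; apply: covered_sub (covered0 _) => u [_] []; exact: emb0.
- by move=> [_ ->].
case: atA => [[C irrC ->]|[F cF ->]]; first exact: shrinks_opt.
move=> Us oUs mUs; have [Qs DQ cov] := star_covered cF shP oUs mUs.
by exists Qs => // Q /DQ; exact: star_shrunk_lt.
Qed.

(** * Descent to a product equal to the language *)

Lemma directed_subset_cover (L : set (seq X)) (Qs : seq (seq (set (seq X)))) :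
  directed L -> {in Qs, forall Q, atoms Q} ->
  (forall u, L u -> exists2 Q, Q \in Qs & prod_lang Q u) ->
  exists2 Q, Q \in Qs & L `<=` prod_lang Q.
Proof.
move=> dL atQs cov; apply: contrapT => H.
(* If [L] lies in none of the products, each is excluded by a list that [L] meets; a word of [L]
   matching all these lists would lie in no product. *)
suff [Uss HU HQ] : exists2 Uss : seq (seq (set X)),
    {in Uss, forall Us, opens Us /\ meets L Us} &
    {in Qs, forall Q, exists2 Us, Us \in Uss & ~ meets (prod_lang Q) Us}.
  have [u Lu uUss] := dL _ HU; have [Q QQ Qu] := cov _ Lu.
  have [Us /uUss uUs] := HQ _ QQ; apply; by exists u.
elim: {cov} Qs atQs H => [_ _|Q Qs IH atQs H]; first by exists [::].
have [||Uss HU HQ] := IH.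
- by move=> S QS; apply: atQs; rewrite inE QS orbT.
- by move=> [S QS LS]; apply: H; exists S => //; rewrite inE QS orbT.
have [w [Lw nQw]] : exists w, L w /\ ~ prod_lang Q w.
  apply: contrapT => H'; apply: H; exists Q; first exact: mem_head.
  by move=> w Lw; apply: contrapT => nQ; apply: H'; exists w.
have [Us [oUs wUs nUs]] : exists Us,
    [/\ opens Us, emb Us w & ~ meets (prod_lang Q) Us].
  apply: contrapT => H'; apply: nQw; apply: closed_prod.
    by apply: atQs; rewrite mem_head.
  by move=> Us oUs wUs; apply: contrapT => nm; apply: H'; exists Us.
exists (Us :: Uss).
  by move=> V; rewrite inE => /predU1P[->|/HU//]; split=> //; exists w.
move=> S; rewrite inE => /predU1P[->|/HQ[V VV]].
  by exists Us; rewrite ?mem_head.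
by exists V => //; rewrite inE VV orbT.
Qed.

Lemma directed_closed_prod (L : set (seq X)) :
  directed L -> subword_closed L -> word_product L.
Proof.
move=> dL cL.
suff descend P :
    Acc prod_lt P -> atoms P -> L `<=` prod_lang P -> word_product L.
  (* The descent starts from the product of all finite words. *)
  have atX : atoms [:: lang_star [set: X]].
    by move=> A; rewrite inE => /eqP ->; right; exists setT.
  by apply: (descend _ (prod_lt_acc atX) atX) => u _; rewrite prod_lang1.
elim=> {}P _ IH atP LP.
case: (pselect (prod_lang P `<=` L)) => [PL|nPL].
  by exists P => //; apply/seteqP.
have [w [Pw nLw]] : exists w, prod_lang P w /\ ~ L w.
  apply: contrapT => H; apply: nPL => w Pw; apply: contrapT => nLw.
  by apply: H; exists w.
have [Us [oUs wUs nLUs]] : exists Us, [/\ opens Us, emb Us w & ~ meets L Us].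
  apply: contrapT => H; apply: nLw; apply: cL => Us oUs wUs.
  by apply: contrapT => nm; apply: H; exists Us.
have [|Qs DQ cov] := shrinks_atoms atP oUs; first by exists w.
have atQs : {in Qs, forall Q, atoms Q}.
  by move=> Q /DQ ltQ; exact: prod_lt_atoms ltQ atP.
have [|Q QQ LQ] := directed_subset_cover dL atQs.
  move=> u Lu; apply: cov; split; first exact: LP.
  by move=> uUs; apply: nLUs; exists u.
by apply: (IH Q) => //; [exact: DQ|exact: atQs].
Qed.

End Noetherian.

(** * The asymptotic subword topology *)

Section InfiniteWords.
Variable X : topologicalType.
Implicit Types (U F : set X) (Us Vs : seq (set X)) (u v : seq X).
Implicit Types (w : fiword X) (f g : nat -> X).
Implicit Types (Q : set (seq X)) (Uss : seq (seq (set X))).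

Definition pref n w : seq X :=
  match w with Fin s => take n s | Inf f => mkseq f n end.

Definition dropw n w : fiword X :=
  match w with
  | Fin s => Fin (drop n s)
  | Inf f => Inf (fun i => f (n + i)%N)
  end.

Lemma onth_pref n w i :
  onth (pref n w) i = if (i < n)%N then letter w i else None.
Proof.
case: w => [s|f] /=.
  elim: s n i => [|x s IH] [|n] [|i] //=.
  - by rewrite if_same.
  - by rewrite IH.
case: ltnP => [lt_in|le_ni]; last by rewrite onth_default ?size_mkseq.
by rewrite onthE (nth_map (f i)) ?size_mkseq// nth_mkseq.
Qed.

Lemma letter_catw u w i :
  letter (catw u w) i =
  if (i < size u)%N then onth u i else letter w (i - size u).
Proof.
case: w => [s|f] /=; first exact: onth_cat.
rewrite /prepend; case: ltnP => [lt_iu|le_ui]; last by rewrite nth_default.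
by rewrite onthE (nth_map (f (i - size u)%N)).
Qed.

Lemma letter_dropw n w i : letter (dropw n w) i = letter w (n + i).
Proof.
case: w => [s|f] //=; elim: n s => [|n IH] s; first by rewrite drop0.
by case: s => [|x s]; [rewrite onth_default|exact: IH].
Qed.

(** Truncated subtraction makes the second factor empty as long as [n] stays within [u]. *)
Lemma pref_catw n u w : pref n (catw u w) = take n u ++ pref (n - size u) w.
Proof.
apply: eq_from_onth => i; rewrite onth_pref letter_catw onth_cat size_take_min.
rewrite leq_min onth_pref -[take n u]/(pref n (Fin u)) onth_pref /=.
case: (ltnP i n) => [lt_in|le_ni] /=.
  case: ltnP => [//|le_ui]; rewrite (minn_idPr (leq_trans le_ui (ltnW lt_in))).
  by rewrite ltn_sub2r// (leq_ltn_trans le_ui).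
by rewrite ltnNge leq_sub// geq_minr.
Qed.

Lemma catw_pref n w : catw (pref n w) (dropw n w) = w.
Proof.
case: w => [s|f] /=; first by rewrite cat_take_drop.
congr Inf; apply/funext => i; rewrite /prepend size_mkseq.
case: (ltnP i n) => [lt_in|le_ni]; first by rewrite nth_mkseq.
by rewrite nth_default ?size_mkseq// subnKC.
Qed.

Lemma catwA u v w : catw (u ++ v) w = catw u (catw v w).
Proof.
case: w => [s|f] /=; first by rewrite catA.
congr Inf; apply/funext => i; rewrite /prepend nth_cat size_cat subnDA.
case: ltnP => [lt_iu|le_ui]; last by rewrite [RHS]nth_default.
exact: set_nth_default.
Qed.

(** * Subwords read through finite prefixes *)

Lemma emb_consP U Us u : emb (U :: Us) u <->
  exists u1 x u2, [/\ u = u1 ++ x :: u2, U x & emb Us u2].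
Proof.
split=> [|[u1 [x [u2 [-> Ux uUs]]]]]; last by apply: emb_catl; left.
elim: u => [//|x u IH] /= [[Ux uUs]|/IH[u1 [y [u2 [-> Uy uUs]]]]].
  by exists [::], x, u.
by exists (x :: u1), y, u2.
Qed.

Lemma subword_from_Fin k Us u : subword_from k Us (Fin u) <-> emb Us (drop k u).
Proof.
elim: Us k => [|U Us IH] k /=; first by split=> // _; exact: emb0.
split=> [[i [le_ki [x ux Ux] /IH uUs]]|/emb_consP[v1 [x [v2 [eqv Ux vUs]]]]].
  have lt_iu : (i < size u)%N by rewrite -onthTE -/(letter (Fin u) i) ux.
  apply/emb_consP; exists (take (i - k) (drop k u)), x, (drop i.+1 u).
  split=> //; rewrite -[LHS](cat_take_drop (i - k)) drop_drop subnK//.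
  congr (_ ++ _); rewrite (drop_nth x)//; congr cons; exact: onth_nth.
have lt_ku : (k + size v1 < size u)%N.
  rewrite -ltn_subRL -size_drop eqv size_cat /=.
  by rewrite -[X in (X < _)%N]addn0 ltn_add2l.
exists (k + size v1)%N; split; first exact: leq_addr.
  exists x => //=; rewrite onthE (nth_map x)// -nth_drop eqv.
  by rewrite nth_cat ltnn subnn.
apply/IH; rewrite -addnS addnC -drop_drop eqv drop_cat ltnNge leqnSn /=.
by rewrite subSn// subnn /= drop0.
Qed.

Lemma subword_from_mono k Us w w' :
  (forall i x, letter w i = Some x -> letter w' i = Some x) ->
  subword_from k Us w -> subword_from k Us w'.
Proof.
move=> ww'; elim: Us k => [//|U Us IH] k /= [i [le_ki [x wx Ux] /IH H]].
by exists i; split=> //; exists x => //; exact: ww'.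
Qed.

(** A subword uses finitely many positions, all inside some prefix; this reduces <U_1; ...; U_n> to
    finite words. *)
Lemma subword_from_pref k Us w : subword_from k Us w ->
  exists n, subword_from k Us (Fin (pref n w)).
Proof.
elim: Us k => [|U Us IH] k /=; first by exists 0%N.
move=> [i [le_ki [x wx Ux] /IH[n nUs]]]; exists (maxn i.+1 n), i; split=> //.
  by exists x => //=; rewrite onth_pref leq_maxl.
apply: subword_from_mono nUs => j y /=; rewrite !onth_pref.
by case: ltnP => // lt_jn; rewrite (leq_trans lt_jn) ?leq_maxr.
Qed.

Lemma subword_setP Us w : subword_set Us w <-> exists n, emb Us (pref n w).
Proof.
split=> [/subword_from_pref[n /subword_from_Fin]|[n nUs]].
  by rewrite drop0; exists n.
have /subword_from_Fin : emb Us (drop 0 (pref n w)) by rewrite drop0.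
by apply: subword_from_mono => i x /=; rewrite onth_pref; case: ifP.
Qed.

Lemma subword_set_Fin Us u : subword_set Us (Fin u) <-> emb Us u.
Proof.
by split=> [/subword_from_Fin|uUs]; [|apply/subword_from_Fin]; rewrite drop0.
Qed.

Lemma emb_pref_mono Us w m n : (m <= n)%N ->
  emb Us (pref m w) -> emb Us (pref n w).
Proof.
move=> le_mn /subword_set_Fin mUs; apply/subword_set_Fin.
apply: subword_from_mono mUs => i x /=; rewrite !onth_pref.
by case: ltnP => // lt_im; rewrite (leq_trans lt_im).
Qed.

Lemma infinitely_oftenU U V w : infinitely_often (U `|` V) w ->
  infinitely_often U w \/ infinitely_often V w.
Proof.
move=> H; apply: contrapT => /not_orP[/existsNP[m nU] /existsNP[n nV]].
have [i] := H (maxn m n); rewrite geq_max => /andP[le_mi le_ni] [x wx [Ux|Vx]].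
  by apply: nU; exists i => //; exists x.
by apply: nV; exists i => //; exists x.
Qed.

(** Finite words belong to it vacuously. *)
Definition eventually_in F : set (fiword X) :=
  [set w | exists n, forall i x, (n <= i)%N -> letter w i = Some x -> F x].

Lemma not_infinitely_often F w :
  ~ infinitely_often (~` F) w -> eventually_in F w.
Proof.
move=> /existsNP[n nF]; exists n => i x le_ni wx; apply: contrapT => nFx.
by apply: nF; exists i => //; exists x.
Qed.

Lemma infinitely_often_eventually U F w : infinitely_often U w ->
  eventually_in F w -> exists2 x, F x & U x.
Proof.
move=> wU [n wF]; have [i le_ni [x wx Ux]] := wU n.
by exists x => //; exact: wF wx.
Qed.

(** Past the last position used for [Us] there is still a letter in [U]. *)
Lemma subword_from_rcons k Us U w : subword_from k Us w ->
  infinitely_often U w -> subword_from k (rcons Us U) w.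
Proof.
move=> + wU; elim: Us k => [|V Us IH] k /=.
  by move=> _; have [i le_ki wi] := wU k; exists i.
by move=> [i [le_ki wi /IH H]]; exists i.
Qed.

(** Recurrence of [U] is insensitive to finite prefixes, so the word can be cut after any prefix
    that already contains the subword. *)
Lemma subword_inf_setE Us U :
  subword_inf_set Us U = subword_set Us `&` infinitely_often U.
Proof.
apply/seteqP; split=> [_ [u /subword_set_Fin uUs [w wU <-]]|w].
  split; first by apply/subword_setP; exists (size u);
    rewrite pref_catw take_size; exact: emb_catr.
  move=> n; have [i le_ni [x wx Ux]] := wU n.
  exists (size u + i)%N; first exact: leq_trans (leq_addl _ _).
  by exists x => //; rewrite letter_catw ltnNge leq_addr /= addKn.
move=> [/subword_setP[n nUs] wU].
exists (pref n w); first exact/subword_set_Fin.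
exists (dropw n w); last exact: catw_pref.
move=> m; have [i le_i [x wx Ux]] := wU (n + m)%N.
exists (i - n)%N; first by rewrite leq_subRL// (leq_trans (leq_addr _ _) le_i).
exists x => //.
by rewrite letter_dropw subnKC// (leq_trans (leq_addr _ _) le_i).
Qed.

(** * Opens of the asymptotic subword topology *)

Lemma open_subbase (W : set (fiword X)) : asymptotic_subbase W -> open W.
Proof.
move=> sW; exists [set W]; last by rewrite bigcup_set1.
by move=> _ ->; exact: finI_from1.
Qed.

Lemma open_subword_set Us : opens Us -> open (subword_set Us : set (fiword X)).
Proof. by move=> oUs; apply: open_subbase; exists Us => //; left. Qed.

Lemma open_infinitely_often U : open U ->
  open (infinitely_often U : set (fiword X)).
Proof.
move=> oU; apply: open_subbase; exists [::] => //; right; exists U => //.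
by rewrite subword_inf_setE; apply/seteqP; split=> // w [].
Qed.

Lemma open_fiwordP (O : set (fiword X)) w : open O -> O w ->
  exists2 Ws : seq (set (fiword X)),
    {in Ws, forall W, asymptotic_subbase W /\ W w} &
    forall w', {in Ws, forall W, W w'} -> O w'.
Proof.
move=> [D sD <-] [i Di iw]; have [E sE eqi] := sD i Di.
exists (enum_fset E) => [W EW|w' H].
  split; first by exact: set_mem (sE _ EW).
  by move: iw; rewrite -eqi => /(_ W EW).
exists i => //; suff: i w' by [].
by rewrite -eqi => W EW; exact: H.
Qed.

End InfiniteWords.

(** * Irreducible closed sets of infinite words *)

Section LimitSets.
Variable X : topologicalType.
Implicit Types (U F : set X) (Us Vs : seq (set X)) (u v : seq X).
Implicit Types (w : fiword X) (f g : nat -> X).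
Implicit Types (P Q : set (seq X)) (Uss : seq (seq (set X))).
Implicit Types (C : set (fiword X)).

(** A form of Q F^{<=omega} in which closedness splits into two tests: the sets <U_1; ...; U_n>
    control the prefixes, and <(oo) U>, with [U] the complement of [F], controls the tail. *)
Definition limit_set Q F : set (fiword X) :=
  [set w | (forall n, Q (pref n w)) /\ eventually_in F w].

Lemma closed_limit_set Q F :
  subword_closed Q -> closed F -> closed (limit_set Q F).
Proof.
move=> cQ cF w clw.
have adh (O : set (fiword X)) :
    open O -> O w -> exists2 w', limit_set Q F w' & O w'.
  move=> oO Ow; have [w' []] := clw O (open_nbhs_nbhs (conj oO Ow)).
  by exists w'.
split=> [n|].
  apply: cQ => Us oUs nUs.
  have [||w' [Qw' _] /subword_setP[m mUs]] := adh (subword_set Us).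
  - exact: open_subword_set.
  - by apply/subword_setP; exists n.
  - by exists (pref m w').
apply: not_infinitely_often => wnF.
have [|w' [_ w'F] w'nF] := adh _ _ wnF.
  by apply: open_infinitely_often; rewrite openC.
by have [x] := infinitely_often_eventually w'nF w'F.
Qed.

Lemma subword_closed_prefix Q u v : subword_closed Q -> Q (u ++ v) -> Q u.
Proof.
move=> cQ Quv; apply: cQ => Us _ uUs.
by exists (u ++ v) => //; exact: emb_catr.
Qed.

(** One way, the cut is made where [w] has settled in [F]; the other way, a prefix of [catw u w] is
    a prefix of [u] followed by a word over [F]. *)
Lemma limit_setE Q F : subword_closed Q ->
  (forall u v, Q u -> lang_star F v -> Q (u ++ v)) ->
  limit_set Q F = [set catw u w | u in Q & w in lang_leomega F].
Proof.
move=> cQ QF; apply/seteqP; split=> [w [Qw [n wF]]|_ [u Qu [w wF <-]]].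
  exists (pref n w) => //; exists (dropw n w); last exact: catw_pref.
  by move=> i x; rewrite letter_dropw; apply: wF; exact: leq_addr.
split=> [n|]; last first.
  exists (size u) => i x le_ui; rewrite letter_catw ltnNge le_ui /=; exact: wF.
rewrite pref_catw; apply: QF.
  apply: (@subword_closed_prefix _ _ (drop n u)) => //.
  by rewrite cat_take_drop.
move=> x /(nthP x)[i]; set s := pref _ w => lt_is <-.
have := onth_pref (n - size u) w i; rewrite -/s onthE (nth_map x)//.
by case: ifP => // _ /esym; exact: wF.
Qed.

(** A finite word over [F] placed before the tail merges with it. *)
Lemma catw_starE P F :
  [set catw u w | u in lang_cat P (lang_star F) & w in lang_leomega F] =
  [set catw u w | u in P & w in lang_leomega F].
Proof.
apply/seteqP; split=> _ [u Pu [w wF <-]].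
  case: Pu => u' Pu' [v vF <-]; exists u' => //; exists (catw v w).
    move=> i x; rewrite letter_catw; case: ltnP => [lt_iv|_]; last exact: wF.
    by rewrite onthE (nth_map x)// => -[<-]; apply: vF; exact: mem_nth.
  by rewrite catwA.
by exists u; [exists u => //; exists [::]; rewrite ?cats0|exists w].
Qed.

(** One letter of [F] in each [V] is collected, and the list is repeated periodically; [x0] keeps
    the period non-empty. *)
Lemma periodic_word F (x0 : X) Vs : F x0 ->
  {in Vs, forall V, exists2 x, F x & V x} ->
  exists2 f, lang_omega F f & {in Vs, forall V, infinitely_often V (Inf f)}.
Proof.
move=> Fx0 FVs.
have [xs xsF xsV] : exists2 xs : seq X, lang_star F xs &
    {in Vs, forall V, exists2 x, x \in xs & V x}.
  elim: Vs FVs => [_|V Vs IH H]; first by exists [::].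
  have [|xs xsF xsV] := IH.
    by move=> W VW; apply: H; rewrite inE VW orbT.
  have [x Fx Vx] := H _ (mem_head _ _); exists (x :: xs).
    by move=> y; rewrite inE => /predU1P[->|/xsF].
  move=> W; rewrite inE => /predU1P[->|/xsV[y xsy Wy]].
    by exists x; rewrite ?mem_head.
  by exists y => //; rewrite inE xsy orbT.
pose s := x0 :: xs.
exists (fun i => nth x0 s (i %% size s)) => [i|V /xsV[x xsx Vx] n].
  have : nth x0 s (i %% size s) \in s by apply: mem_nth; rewrite ltn_mod.
  by rewrite inE => /predU1P[->|/xsF].
have sx : x \in s by rewrite inE xsx orbT.
(* An occurrence of [x] after [n] full periods, hence at a position at least [n]. *)
exists (n * size s + index x s)%N.
  by rewrite (leq_trans _ (leq_addr _ _))// leq_pmulr.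
by exists x => //; congr Some; rewrite modnMDl modn_small ?index_mem ?nth_index.
Qed.

(** Separates subword conditions, which concern [Q], from recurrence conditions, which concern [F],
    so that they can be met independently. *)
Lemma subbase_meetP Q F C (Ws : seq (set (fiword X))) :
  C `<=` limit_set Q F ->
  {in Ws, forall W, asymptotic_subbase W /\ exists2 w, C w & W w} ->
  exists Uss Vs, [/\ {in Uss, forall Us, opens Us /\ meets Q Us},
    {in Vs, forall V, exists2 x, F x & V x} &
    forall w, {in Uss, forall Us, subword_set Us w} ->
      {in Vs, forall V, infinitely_often V w} -> {in Ws, forall W, W w}].
Proof.
move=> CQF; elim: Ws => [_|W Ws IH H]; first by exists [::], [::].
have [|Uss [Vs [HU HV HW]]] := IH.
  by move=> W' WW'; apply: H; rewrite inE WW' orbT.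
have [[Us oUs sW] [w Cw Ww]] := H _ (mem_head _ _).
have [Qw wF] := CQF _ Cw.
have mUs : subword_set Us w -> meets Q Us.
  by move=> /subword_setP[n nUs]; exists (pref n w).
case: sW => [eqW|[U oU eqW]]; rewrite eqW in Ww *.
  exists (Us :: Uss), Vs; split=> //.
    by move=> Us'; rewrite inE => /predU1P[->|/HU//]; split=> //; exact: mUs.
  move=> w' wUss wVs W'; rewrite inE => /predU1P[->|].
    by apply: wUss; exact: mem_head.
  by apply: HW => // Us' UU; apply: wUss; rewrite inE UU orbT.
move: Ww; rewrite subword_inf_setE => -[wUs wU].
exists (Us :: Uss), (U :: Vs); split.
- by move=> Us'; rewrite inE => /predU1P[->|/HU//]; split=> //; exact: mUs.
- move=> V; rewrite inE => /predU1P[->|/HV//].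
  exact: infinitely_often_eventually wU wF.
move=> w' wUss wVs W'; rewrite inE => /predU1P[->|].
  by split; [apply: wUss|apply: wVs]; exact: mem_head.
by apply: HW => [Us' UU|V VV]; [apply: wUss|apply: wVs];
  rewrite inE ?UU ?VV orbT.
Qed.

(** A word of [Q] with all the required subwords, followed by a periodic word over [F], is a common
    point of finitely many subbasic opens met by [C]. Leaving [C] general serves both [fiword X] and
    the image of the infinite words. *)
Lemma irreducible_limit_set Q F C : directed Q -> C `<=` limit_set Q F ->
  (forall u f, Q u -> lang_omega F f -> C (Inf (prepend u f))) ->
  (F = set0 -> forall u, Q u -> C (Fin u)) ->
  irreducible_set C.
Proof.
move=> dQ CQF Cinf Cfin.
have meet (Ws : seq (set (fiword X))) :
    {in Ws, forall W, asymptotic_subbase W /\ exists2 w, C w & W w} ->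
    exists2 w, C w & {in Ws, forall W, W w}.
  move=> HWs; have [Uss [Vs [HU HV HW]]] := subbase_meetP CQF HWs.
  have [u Qu uUss] := dQ _ HU.
  (* With [F] empty there is no recurrence condition, and the finite word [u] is enough. *)
  case: (pselect (F !=set0)) => [[x0 Fx0]|/set0P/negP/negbNE/eqP F0];
    last first.
    exists (Fin u); first exact: Cfin.
    apply: HW => [Us /uUss uUs|V /HV[x]]; first exact/subword_set_Fin.
    by rewrite F0.
  have [f fF fVs] := periodic_word Fx0 HV.
  exists (Inf (prepend u f)); first exact: Cinf.
  apply: HW => [Us /uUss uUs|V /fVs fV n].
    apply/subword_setP; exists (size u).
    by rewrite (pref_catw _ _ (Inf f)) take_size; exact: emb_catr.
  have [i le_ni [x fx Vx]] := fV n; exists (size u + i)%N.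
    exact: leq_trans (leq_addl _ _).
  by exists x => //; rewrite (letter_catw _ (Inf f)) ltnNge leq_addr addKn.
split; first by have [|w Cw _] := meet [::] => //; exists w.
move=> C1 C2 cC1 cC2 C12; apply: contrapT => /not_orP[nC1 nC2].
have pick D : closed D -> ~ C `<=` D -> exists2 Ws : seq (set (fiword X)),
    {in Ws, forall W, asymptotic_subbase W /\ exists2 w, C w & W w} &
    forall w, {in Ws, forall W, W w} -> ~ D w.
  move=> cD nCD; have [w [Cw nDw]] : exists w, C w /\ ~ D w.
    apply: contrapT => H; apply: nCD => w Cw; apply: contrapT => nDw.
    by apply: H; exists w.
  have oD : open (~` D) by rewrite openC.
  have [Ws HW WD] := open_fiwordP oD nDw; exists Ws => //.
  by move=> W /HW[sW Ww]; split=> //; exists w.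
have [Ws1 H1 nD1] := pick _ cC1 nC1; have [Ws2 H2 nD2] := pick _ cC2 nC2.
have [|w Cw wWs] := meet (Ws1 ++ Ws2).
  by move=> W; rewrite mem_cat => /orP[/H1|/H2].
case: (C12 _ Cw); first by apply: nD1 => W W1; apply: wWs; rewrite mem_cat W1.
by apply: nD2 => W W2; apply: wWs; rewrite mem_cat W2 orbT.
Qed.

(** * From irreducible closed sets to products *)

Lemma irreducible_closed_memP C w : irreducible_closed C ->
  (forall Us, opens Us -> subword_set Us w ->
     exists2 w', C w' & subword_set Us w') ->
  (forall U, open U -> infinitely_often U w ->
     exists2 w', C w' & infinitely_often U w') ->
  C w.
Proof.
move=> [cC irrC] HS HI; apply: contrapT => nCw.
have oC : open (~` C) by rewrite openC.
have [Ws HW WC] := open_fiwordP oC nCw.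
(* By irreducibility, opens that each meet [C] meet it in a common point, so they can be tested one
   at a time. *)
have [|w' Cw' /WC//] := @irreducible_meetsI _ C Ws irrC.
move=> W /HW[sW Ww]; split; first exact: open_subbase.
have [Us oUs [eqW|[U oU eqW]]] := sW; rewrite eqW in Ww *; first exact: HS.
move: Ww; rewrite subword_inf_setE => -[wUs wU].
have [|w' Cw' H] := @irreducible_meetsI _ C
    [:: subword_set Us; infinitely_often U] irrC.
  move=> W'; rewrite !inE => /orP[]/eqP->; split.
  - exact: open_subword_set.
  - exact: HS.
  - exact: open_infinitely_often.
  - exact: HI.
by exists w' => //; split; apply: H; rewrite !inE eqxx ?orbT.
Qed.

Lemma not_infinitely_often_Fin U u : ~ infinitely_often U (Fin u).
Proof.
by move=> /(_ (size u))[i le_ui [x /=]]; rewrite onth_default.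
Qed.

(** A prefix has only subwords of [w], and in a finite word nothing recurs. *)
Lemma irreducible_closed_pref C w n : irreducible_closed C -> C w ->
  C (Fin (pref n w)).
Proof.
move=> irrC Cw; apply: irreducible_closed_memP => // [Us _|U _].
  move=> /subword_set_Fin nUs; exists w => //; apply/subword_setP; by exists n.
by move=> /not_infinitely_often_Fin.
Qed.

(** Noetherian descent from the whole space: while some open [U] meets [G] but recurs in no word of
    [C], [U] is removed from [G]. Letters recurring outside the new set would recur outside [G] or
    in [U]. *)
Lemma tail_support (noethX : noetherian X) C : exists F, [/\ closed F,
  (forall w, C w -> eventually_in F w) &
  forall U, open U -> (exists2 x, F x & U x) ->
    exists2 w, C w & infinitely_often U w].
Proof.
suff : forall G, closed G -> (forall w, C w -> ~ infinitely_often (~` G) w) ->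
    exists F, [/\ closed F, (forall w, C w -> ~ infinitely_often (~` F) w) &
      forall U, open U -> (exists2 x, F x & U x) ->
        exists2 w, C w & infinitely_often U w].
  move=> /(_ setT closedT)[|F [cF CF HF]].
    by move=> w _; rewrite setCT => /(_ 0%N)[i _ [x _]].
  by exists F; split=> // w /CF; exact: not_infinitely_often.
apply: (well_founded_ind (closed_lt_wf noethX)) => G IH cG CG.
case: (pselect (exists2 U, open U &
    (exists2 x, G x & U x) /\ forall w, C w -> ~ infinitely_often U w));
  last first.
  move=> H; exists G; split=> // U oU GU; apply: contrapT => nU; apply: H.
  by exists U => //; split=> // w Cw wU; apply: nU; exists w.
move=> [U oU [[x Gx Ux] CU]].
have cGU : closed (G `\` U) by rewrite setDE; apply: closedI; rewrite ?closedC.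
apply: (IH (G `\` U)) => //.
  by split=> //; split=> [y []//|] /(_ _ Gx)[].
move=> w Cw; rewrite setDE setCI setCK.
by move=> /infinitely_oftenU[]; [exact: CG|exact: CU].
Qed.

(** Irreducibility gives one word of [C] with all the required subwords; a long enough prefix keeps
    them and stays in [C]. *)
Lemma directed_words C : irreducible_closed C -> directed [set u | C (Fin u)].
Proof.
move=> irrC Uss HU.
have [|w Cw wUss] := @irreducible_meetsI _ C (map (@subword_set X) Uss) irrC.2.
  move=> _ /mapP[Us /HU[oUs [u Cu uUs]] ->].
  split; first exact: open_subword_set.
  by exists (Fin u) => //; exact/subword_set_Fin.
have [n nUss] : exists n, {in Uss, forall Us, emb Us (pref n w)}.
  elim: Uss {HU} wUss => [|Us Uss IH] H; first by exists 0%N.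
  have [|n nUss] := IH.
    by move=> W /mapP[V UV ->]; apply: H; rewrite map_f// inE UV orbT.
  have /subword_setP[m mUs] : subword_set Us w by apply: H; rewrite mem_head.
  exists (maxn m n) => V; rewrite inE => /predU1P[->|/nUss].
    by apply: emb_pref_mono mUs; exact: leq_maxl.
  by apply: emb_pref_mono; exact: leq_maxr.
by exists (pref n w) => //; exact: irreducible_closed_pref.
Qed.

Lemma closed_words C : irreducible_closed C ->
  subword_closed [set u | C (Fin u)].
Proof.
move=> irrC u Hu; apply: irreducible_closed_memP => // [Us oUs|U _].
  move=> /subword_set_Fin /(Hu _ oUs)[v Cv vUs].
  by exists (Fin v) => //; exact/subword_set_Fin.
by move=> /not_infinitely_often_Fin.
Qed.

Lemma irreducible_closed_limit_set (noethX : noetherian X) C :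
  irreducible_closed C -> exists Q F,
    [/\ word_product Q, closed F &
        C = [set catw u w | u in Q & w in lang_leomega F]].
Proof.
move=> irrC; have [F [cF CF HF]] := tail_support noethX C.
pose Q := [set u | C (Fin u)].
have dQ := directed_words irrC; have cQ := closed_words irrC.
exists Q, F; split=> //; first exact: directed_closed_prod.
(* Letters of [F] can be appended within [Q]: an open [U] containing such a letter recurs in some
   word of [C], and by irreducibility in one that also has the subword [Us1], after which a letter
   in [U] still comes. *)
have QF u v : Q u -> lang_star F v -> Q (u ++ v).
  elim/last_ind: v => [|v x IH] Qu vF; first by rewrite cats0.
  have {IH}Quv : Q (u ++ v).
    by apply: IH => // y vy; apply: vF; rewrite mem_rcons inE vy orbT.
  have Fx : F x by apply: vF; rewrite mem_rcons mem_head.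
  rewrite -rcons_cat -cats1; apply: cQ => Us oUs.
  move=> /emb_split[Us1 [Us2 [eqUs uUs1 xUs2]]].
  move: oUs; rewrite eqUs => /opens_cat[oUs1].
  case: Us2 xUs2 {eqUs} => [_ _|U [|V Us2]].
  - by exists (u ++ v); rewrite ?cats0.
  - move=> /= [[Ux _]|//] /opens_cons[oU _].
    have [|w Cw wU] := HF U oU; first by exists x.
    have [|w' Cw' H] := @irreducible_meetsI _ C
        [:: subword_set Us1; infinitely_often U] irrC.2.
      move=> W'; rewrite !inE => /orP[]/eqP->; split.
      + exact: open_subword_set.
      + by exists (Fin (u ++ v)) => //; exact/subword_set_Fin.
      + exact: open_infinitely_often.
      + by exists w.
    have /subword_setP[n nUs] : subword_set (Us1 ++ [:: U]) w'.
      rewrite cats1; apply: subword_from_rcons; apply: H;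
        by rewrite !inE eqxx ?orbT.
    by exists (pref n w') => //; exact: irreducible_closed_pref.
  - by move=> /= [[_ []]|].
rewrite -limit_setE//; apply/seteqP; split=> [w Cw|w [Qw wF]].
  by split=> [n|]; [exact: irreducible_closed_pref|exact: CF].
(* Prefixes in [Q] supply the subwords; a [U] recurring in [w] meets [F], hence recurs in some word
   of [C]. *)
apply: irreducible_closed_memP => // [Us oUs /subword_setP[n nUs]|U oU wU].
  by exists (Fin (pref n w)); [exact: Qw|exact/subword_set_Fin].
by apply: HF => //; exact: infinitely_often_eventually wU wF.
Qed.

(** * Products are irreducible closed *)

Lemma prod_limit_setE As F : atoms As -> closed F ->
  let Q := prod_lang (As ++ [:: lang_star F]) in
  [/\ directed Q, subword_closed Q &
    [set catw u w | u in prod_lang As & w in lang_leomega F] = limit_set Q F].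
Proof.
move=> atAs cF Q.
(* The extra star makes [Q] stable under appending words over [F], as [limit_setE] requires. *)
have atQ : atoms (As ++ [:: lang_star F]).
  apply/atoms_cat; split=> // A; rewrite inE => /eqP ->.
  by right; exists F.
have cQ : subword_closed Q := closed_prod atQ.
have QE : Q = lang_cat (prod_lang As) (lang_star F).
  by rewrite /Q prod_lang_cat prod_lang1.
split=> //; first exact: directed_prod.
rewrite limit_setE//; first by rewrite QE catw_starE.
rewrite QE => _ v [u Pu [v' v'F <-]] vF; exists u => //.
exists (v' ++ v); last by rewrite catA.
by move=> x; rewrite mem_cat => /orP[/v'F|/vF].
Qed.

Lemma fi_product_irreducible_closed (L : set (fiword X)) :
  finite_or_infinite_word_product L -> irreducible_closed L.
Proof.
move=> [_ [F [[As atAs ->] cF ->]]].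
have [dQ cQ eqL] := prod_limit_setE atAs cF.
split; first by rewrite eqL; exact: closed_limit_set.
apply: (irreducible_limit_set (F := F) dQ); first by rewrite eqL => w.
  move=> u f Qu fF; rewrite -catw_starE; exists u.
    by rewrite prod_lang_cat prod_lang1 in Qu.
  by exists (Inf f) => // i x [<-].
move=> _ u Qu; rewrite -catw_starE; exists u.
  by rewrite prod_lang_cat prod_lang1 in Qu.
by exists (Fin [::]) => [i x|] /=; rewrite ?cats0// onth0n.
Qed.

(** * Transfer to infinite words *)

Lemma inf_product_preimage P F :
  [set prepend u f | u in P & f in lang_omega F] =
  @Inf X @^-1` [set catw u w | u in P & w in lang_leomega F].
Proof.
apply/seteqP; split=> [_ [u Pu [f fF <-]]|g [u Pu [[//|f] fF [<-]]]].
  by exists u => //; exists (Inf f) => // i x [<-].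
by exists u => //; exists f => // i; exact: (fF i).
Qed.

Lemma closed_iwordP (C : set (iword X)) :
  closed C <-> exists2 K : set (fiword X), closed K & C = @Inf X @^-1` K.
Proof.
split=> [cC|[K cK ->]].
  have [A oA eqA] : open (~` C) by rewrite openC.
  exists (~` A); first by rewrite closedC.
  by rewrite -[LHS]setCK -eqA.
rewrite -openC; exists (~` K); first by rewrite openC.
by rewrite preimage_setC.
Qed.

(** Closed sets of the subspace are traces of closed sets, so irreducibility does not depend on the
    ambient space. *)
Lemma irreducible_iwordP (L : set (iword X)) :
  irreducible_set L <-> irreducible_set (@Inf X @` L : set (fiword X)).
Proof.
split=> [[[g Lg] irrL]|[[_ [g Lg _]] irrL]].
  split; first by exists (Inf g); exists g.
  move=> C1 C2 cC1 cC2 L12.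
  have [] := irrL (@Inf X @^-1` C1) (@Inf X @^-1` C2).
  - by apply/closed_iwordP; exists C1.
  - by apply/closed_iwordP; exists C2.
  - by move=> h Lh; apply: L12; exists h.
  - by move=> LC; left=> _ [h /LC ? <-].
  - by move=> LC; right=> _ [h /LC ? <-].
split; first by exists g.
move=> C1 C2 /closed_iwordP[K1 cK1 ->] /closed_iwordP[K2 cK2 ->] L12.
have [] := irrL K1 K2 cK1 cK2; first by move=> _ [h /L12 ? <-].
- by move=> LK; left=> h Lh; apply: LK; exists h.
- by move=> LK; right=> h Lh; apply: LK; exists h.
Qed.

(** The criterion is applied to the image of [L] under [Inf], not to the full limit set; the letter
    [x0] of [F] rules out its finite-word clause. *)
Lemma inf_product_irreducible_closed (L : set (iword X)) :
  infinite_word_product L -> irreducible_closed L.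
Proof.
move=> [_ [F [[As atAs ->] cF [x0 Fx0] ->]]].
have [dQ cQ eqL] := prod_limit_setE atAs cF.
split.
  apply/closed_iwordP; rewrite inf_product_preimage; eexists; last by [].
  by rewrite eqL; exact: closed_limit_set.
apply/irreducible_iwordP; apply: (irreducible_limit_set (F := F) dQ).
- by rewrite -eqL inf_product_preimage => _ [f Lf <-].
- move=> u f Qu fF; exists (prepend u f) => //; rewrite inf_product_preimage.
  rewrite -catw_starE; exists u; last by exists (Inf f) => // i x [<-].
  by rewrite prod_lang_cat prod_lang1 in Qu.
- by move=> F0; rewrite F0 in Fx0.
Qed.

Lemma irreducible_closure (T : topologicalType) (D : set T) :
  irreducible_set D -> irreducible_closed (closure D).
Proof.
move=> [[x Dx] irrD]; split; first exact: closed_closure.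
split; first by exists x; exact: subset_closure.
move=> C1 C2 cC1 cC2 D12; have [||] := irrD C1 C2 cC1 cC2.
- exact: subset_trans (@subset_closure _ D) D12.
- by move=> DC1; left; rewrite closureE => y; apply.
- by move=> DC2; right; rewrite closureE => y; apply.
Qed.

Lemma irreducible_closed_inf_product
    (noethX : noetherian X) (L : set (iword X)) :
  irreducible_closed L -> infinite_word_product L.
Proof.
move=> [cL irrL]; have [[g Lg] _] := irrL.
have /irreducible_closure irrK := (irreducible_iwordP L).1 irrL.
(* Since [L] is closed in the subspace, its closure adds no infinite word. *)
have LK : L = @Inf X @^-1` closure (@Inf X @` L).
  apply/seteqP; split=> [h Lh|h]; first by apply: subset_closure; exists h.
  have [K cK eqL] := (closed_iwordP L).1 cL.
  rewrite /= closureE eqL; apply; split=> //.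
  by rewrite -eqL => _ [f Lf <-]; move: Lf; rewrite eqL.
have [P [F [prodP cF eqK]]] := irreducible_closed_limit_set noethX irrK.
rewrite eqK -inf_product_preimage in LK.
exists P, F; split=> //.
(* The infinite tail of [g] supplies a letter of [F]. *)
by move: Lg; rewrite LK => -[u _ [f fF _]]; exists (f 0%N).
Qed.

End LimitSets.
Theorem theorem5p13 (X : topologicalType) (hX : noetherian X) :
  (forall L : set (fiword X),
     irreducible_closed L <-> finite_or_infinite_word_product L) /\
  (forall L : set (iword X),
     irreducible_closed L <-> infinite_word_product L).
Proof.
split=> L; split.
- exact: irreducible_closed_limit_set.
- exact: fi_product_irreducible_closed.
- exact: irreducible_closed_inf_product.
- exact: inf_product_irreducible_closed.
Qed.
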